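(* Let $z\in\mathbb{C}\setminus\{0\}$, $0\le x<1$, and let $s\in\mathbb{C}$ with $\sigma=\Re(s)>\frac{\log |z|}{\log\alpha_1}$. Then $$\varphi(z,s,x)=\sum_{j=0}^{\infty}\binom{-s}{j}\,\varphi(z,s+j,0)\,x^j .$$
   Context: Setting: $\{a_n\}_{n\ge 1}$ is a linear recurrence sequence over $\mathbb{Z}$, i.e. a sequence of integers for which there is a monic $Q\in\mathbb{Z}[X]$ with $Q(\nabla)a_n=0$ for all $n$, where $\nabla a_n=a_{n+1}$. Its minimal polynomial $P\in\mathbb{Z}[X]$ (the monic polynomial of least degree with $P(\nabla)$ annihilating $\{a_n\}$) is assumed irreducible over $\mathbb{Q}$, of degree $r$, with (simple) roots $\alpha_1,\dots,\alpha_r\in\mathbb{C}$, and $\alpha_1$ is a dominant root: $\alpha_1$ is real, $\alpha_1>1$ and $\alpha_1>|\alpha_i|$ for $i=2,\dots,r$. The sequence $\{a_n\}$ is assumed to be a strictly increasing sequence of positive integers. For $0\le x<1$, define the Dirichlet series $$\varphi(z,s,x)=\sum_{n=1}^{\infty}\frac{z^n}{(a_n+x)^s},\qquad \Re(s)>\frac{\log|z|}{\log\alpha_1},$$ where $(a_n+x)^s=e^{s\log(a_n+x)}$ with the real logarithm. For $j\ge 0$, $\binom{-s}{j}=\frac{(-s)(-s-1)\cdots(-s-j+1)}{j!}$ (equal to $1$ for $j=0$), and $x^0=1$ (also for $x=0$). *)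

(* Defs.v *)
From mathcomp Require Export all_boot all_order all_algebra.
From mathcomp Require Export complex.
From mathcomp Require Export all_classical all_reals all_analysis.

Set Implicit Arguments.
Unset Strict Implicit.
Unset Printing Implicit Defensive.

Export Order.TTheory GRing.Theory Num.Theory numFieldNormedType.Exports.

Local Open Scope classical_set_scope.
Local Open Scope ring_scope.
Local Open Scope complex_scope.

(* A sequence (a_n)_{n >= 1} is a function a : nat -> int whose value at 0 is
   irrelevant: every condition below only involves indices n >= 1. *)

Definition nabla (a : nat -> int) : nat -> int := fun n => a n.+1.

(* Q(nabla) a *)
Definition poly_nabla (Q : {poly int}) (a : nat -> int) : nat -> int :=
  fun n => \sum_(i < size Q) Q`_i * iter i nabla a n.

Definition annihilates (Q : {poly int}) (a : nat -> int) : Prop :=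
  forall n, (0 < n)%N -> poly_nabla Q a n = 0.

Definition linear_recurrence (a : nat -> int) : Prop :=
  exists2 Q : {poly int}, Q \is monic & annihilates Q a.

Definition minimal_polynomial (a : nat -> int) (P : {poly int}) : Prop :=
  [/\ P \is monic,
      annihilates P a &
      forall Q : {poly int},
        Q \is monic -> annihilates Q a -> (size P <= size Q)%N].

Definition irreducible_over_rat (P : {poly int}) : Prop :=
  irreducible_poly (map_poly (intr : int -> rat) P).

Definition strictly_increasing (a : nat -> int) : Prop :=
  forall m n, (0 < m)%N -> (m < n)%N -> a m < a n.

Section Complex.
Variable R : realType.
Implicit Types (s w z : R[i]) (x : R).

Definition complex_root (P : {poly int}) w : Prop :=
  root (map_poly (intr : int -> R[i]) P) w.

(* The modulus as an element of R; the library's `|w| lies in R[i]. *)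
Definition cmod w : R := complex.Re `|w|.

Definition dominant_root (P : {poly int}) (alpha1 : R) : Prop :=
  [/\ complex_root P alpha1%:C,
      1 < alpha1 &
      forall w, complex_root P w -> w != alpha1%:C -> cmod w < alpha1].

Definition cexp w : R[i] :=
  (expR (complex.Re w))%:C * (cos (complex.Im w) +i* sin (complex.Im w)).

(* t ^ s for real t > 0, with the real logarithm *)
Definition cpow (t : R) s : R[i] := cexp (s * (ln t)%:C).

Definition cbinom w (j : nat) : R[i] :=
  (\prod_(i < j) (w - i%:R)) / (j`!)%:R.

(* R[i]^o is R[i] with the topology of its norm. *)
Definition phi_partial (a : nat -> int) z s x : nat -> R[i]^o :=
  fun N => \sum_(1 <= n < N.+1) z ^+ n / cpow ((a n)%:~R + x) s.

(* Meaningful only where phi_partial converges. *)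
Definition phi (a : nat -> int) z s x : R[i]^o := limn (phi_partial a z s x).

End Complex.

(* Main.v *)
Require Import Defs.
From mathcomp Require Import ring lra.

Set Implicit Arguments.
Unset Strict Implicit.
Unset Printing Implicit Defensive.

Local Open Scope classical_set_scope.
Local Open Scope ring_scope.
Local Open Scope complex_scope.

(** Formally the identity is the binomial series
    (a_n + x)^(-s) = a_n^(-s) * sum_j binom(-s, j) (x / a_n)^j, multiplied by
    z^n and summed over n; the analytic content is convergence and the exchange
    of the two sums.

    Convergence needs a_n to grow like alpha_1^n, up to subexponential factors
    and in both directions, since Re s may have either sign.  The lower bound
    comes from the factorization P = Q * (X - alpha_1): the sequence
    b = Q(nabla) a is geometric of ratio alpha_1, and each b_n is a fixed linear
    combination of finitely many a_(n+i), hence is controlled by the largest of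
    them because a increases.  The point is that b is not zero
    ([lower_degree_act_neq0_ext]): a nonzero real polynomial of degree smaller
    than deg P that kills a would make a Hankel determinant of a vanish, hence yield
    a rational polynomial of that kind, which is coprime to the irreducible P,
    and a would be 0.  The upper bound |a_n| <= C beta^n, for every
    beta > alpha_1, peels off the roots of P one at a time
    ([split_recurrence_growth]).  With these bounds, and because
    |z| < alpha_1^(Re s), the terms of all the series in the theorem are
    dominated by one convergent geometric series K q^n ([dterm_majorant]).

    The exchange uses an estimate of the binomial remainder that is uniform on
    [0, x] ([binomial_remainder]).  If p_J is the J-th partial sum of the
    series of (1 + y)^(-s), the recurrence of the binomial coefficients
    telescopes the derivative of p_J(y) (1 + y)^s into the single term
    - J binom(-s, J) y^(J-1) (1 + y)^(s-1); by the mean value inequality the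
    remainder is at most a constant times J |binom(-s, J)| x^J, which tends
    to 0 by the ratio test.  Since 0 <= x / a_n <= x for all n, summing against
    K q^n bounds the difference between phi(z, s, x) and the J-th partial sum of
    the expansion by a constant times this quantity ([phi_expansion]). *)

(** * Polynomials in the shift operator *)

Section ShiftAction.
Variable F : comNzRingType.
Implicit Types (p q : {poly F}) (u : nat -> F).

(** The operator p(nabla), over an arbitrary ring: the recurrence with integer
    coefficients has to be read over the rational, real and complex numbers. *)
Definition shift_act p u : nat -> F :=
  fun n => \sum_(i < size p) p`_i * u (n + i)%N.

Lemma shift_act_widen p u n m : (size p <= m)%N ->
  shift_act p u n = \sum_(i < m) p`_i * u (n + i)%N.
Proof.
move=> le_pm; rewrite /shift_act.
rewrite (big_ord_widen _ (fun i => p`_i * u (n + i)%N) le_pm).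
rewrite big_mkcond /=; apply: eq_bigr => i _; case: ltnP => // le_pi.
by rewrite nth_default ?mul0r.
Qed.

Lemma shift_actD p q u n :
  shift_act (p + q) u n = shift_act p u n + shift_act q u n.
Proof.
set m := maxn (size p) (size q).
rewrite !(@shift_act_widen _ _ _ m) ?leq_maxl ?leq_maxr //; last first.
  exact: size_polyD.
by rewrite -big_split; apply: eq_bigr => i _; rewrite coefD mulrDl.
Qed.

Lemma shift_actZ c p u n : shift_act (c *: p) u n = c * shift_act p u n.
Proof.
rewrite !(@shift_act_widen _ _ _ (size p)) ?size_scale_leq // mulr_sumr.
by apply: eq_bigr => i _; rewrite coefZ mulrA.
Qed.

Lemma shift_actC c u n : shift_act c%:P u n = c * u n.
Proof.
rewrite (@shift_act_widen _ _ _ 1%N) ?size_polyC_leq1 //.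
by rewrite big_ord1 coefC addn0.
Qed.

Lemma shift_actMX p u n : shift_act (p * 'X) u n = shift_act p u n.+1.
Proof.
rewrite !(@shift_act_widen _ _ _ (size p).+1) ?leqnSn //; last first.
  by rewrite (leq_trans (size_polyMleq _ _)) // size_polyX addn2.
rewrite big_ord_recl coefMX mul0r add0r.
rewrite big_ord_recr /= nth_default // mul0r addr0.
by apply: eq_bigr => i _; rewrite coefMX /= addnS.
Qed.

Lemma shift_actM p q u n :
  shift_act (p * q) u n = shift_act p (shift_act q u) n.
Proof.
elim/poly_ind: p n => [|p c IH] n.
  by rewrite mul0r /shift_act size_poly0 !big_ord0.
rewrite mulrDl mulrAC shift_actD shift_actMX mul_polyC shift_actZ IH.
by rewrite shift_actD shift_actMX shift_actC.
Qed.

Lemma shift_act_XsubC c u n : shift_act ('X - c%:P) u n = u n.+1 - c * u n.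
Proof.
by rewrite -['X]mul1r -polyCN shift_actD shift_actMX !shift_actC mul1r mulNr.
Qed.

Lemma shift_act_eq0 p u : (forall n, u n = 0) -> forall n, shift_act p u n = 0.
Proof. by move=> u0 n; apply: big1 => i _; rewrite u0 mulr0. Qed.

(** A monic recurrence determines each value from the preceding deg p ones. *)
Lemma shift_act_init0 p u : p \is monic -> (forall n, shift_act p u n = 0) ->
  (forall n, (n < (size p).-1)%N -> u n = 0) -> forall n, u n = 0.
Proof.
move=> p_mon pu0 init0; elim/ltn_ind => n IH.
have [/init0 //|le_pn] := ltnP n (size p).-1.
have := pu0 (n - (size p).-1)%N.
rewrite (@shift_act_widen _ _ _ (size p).-1.+1) ?leqSpred //.
rewrite big_ord_recr /= subnK // -/(lead_coef p) (monicP p_mon) mul1r.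
rewrite big1 ?add0r // => i _; rewrite IH ?mulr0 //.
by rewrite -[X in (_ < X)%N](subnK le_pn) ltn_add2l.
Qed.

End ShiftAction.

Lemma shift_act_map (A B : comNzRingType) (f : {rmorphism A -> B})
    (p : {poly A}) (u : nat -> A) n :
  shift_act (map_poly f p) (f \o u) n = f (shift_act p u n).
Proof.
rewrite (@shift_act_widen _ _ _ _ (size p)); last exact: size_poly.
by rewrite rmorph_sum; apply: eq_bigr => i _; rewrite coef_map /= rmorphM.
Qed.

Lemma annihilates_shift_act (P : {poly int}) (a : nat -> int) n :
  annihilates P a -> shift_act P (a \o succn) n = 0.
Proof.
move=> /(_ n.+1 isT); rewrite /poly_nabla => <-.
apply: eq_bigr => i _; congr (_ * _).
rewrite /= -addSn.
by elim: (nat_of_ord i) n.+1 => [|k IH] m; rewrite /= ?addn0 // addnS -addSn IH.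
Qed.

(** By irreducibility q is coprime to p, and a Bezout relation between p and q
    shows that u = 0 if both p(nabla) and q(nabla) kill u. *)
Lemma lower_degree_act_neq0 (F : fieldType) (p q : {poly F}) (u : nat -> F) :
  irreducible_poly p -> (forall n, shift_act p u n = 0) ->
  q != 0 -> (size q < size p)%N -> (exists n, u n != 0) ->
  exists n, shift_act q u n != 0.
Proof.
move=> p_irr pu0 q0 lt_qp [m um]; apply: contrapT => qu0.
have /Bezout_eq1_coprimepP[[v w] /= vw1] : coprimep p q.
  rewrite irreducible_poly_coprime //; apply/negP => /(dvdp_leq q0).
  by rewrite leqNgt lt_qp.
move: um; rewrite -[u m]mul1r -shift_actC polyC1 -vw1 shift_actD !shift_actM.
rewrite !shift_act_eq0 ?addr0 ?eqxx // => n; apply/eqP/negP => qun.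
by apply: qu0; exists n; apply/negP.
Qed.

(** The coefficients of Q may be irrational, so irreducibility of P over the
    rationals does not apply to Q directly.  But Q(nabla) u = 0 is a linear
    relation between the rows of an integer Hankel matrix of order deg P, whose
    determinant is then 0, so the rows are also related over the rationals.
    The rational relation is only known on the first deg P values, and the
    recurrence P propagates it. *)
Lemma lower_degree_act_neq0_ext (F : numFieldType) (P : {poly int})
    (u : nat -> int) (Q : {poly F}) :
  P \is monic -> irreducible_over_rat P -> (forall n, shift_act P u n = 0) ->
  (exists n, u n != 0) -> Q != 0 -> (size Q < size P)%N ->
  exists n, shift_act Q (intr \o u) n != 0.
Proof.
move=> P_mon P_irr Pu0 [m um] Q0 lt_QP; apply: contrapT => Qu0.
pose r := (size P).-1.
have sPr : size P = r.+1 by rewrite prednK // size_poly_gt0 monic_neq0.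
have sQr : (size Q <= r)%N by rewrite -ltnS -sPr.
pose H := \matrix_(i < r, j < r) u (j + i)%N.
have act_row (K : fieldType) (w : 'rV[K]_r) (j : 'I_r) :
    (w *m map_mx intr H) 0 j = shift_act (rVpoly w) (intr \o u) j.
  rewrite mxE (@shift_act_widen _ _ _ _ r); last exact: size_poly.
  by apply: eq_bigr => i _; rewrite coef_rVpoly_ord !mxE.
have /eqP detH0 : \det H == 0.
  rewrite -(@intr_eq0 F) -det_map_mx; apply/det0P; exists (poly_rV Q).
    by apply: contraNneq Q0 => Qr0; rewrite -(poly_rV_K sQr) Qr0 linear0.
  apply/rowP => j; rewrite act_row poly_rV_K // mxE; apply/eqP/negP => Quj.
  by apply: Qu0; exists j; apply/negP.
have /det0P[w w0 wH0] : \det (map_mx (intr : int -> rat) H) == 0.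
  by rewrite det_map_mx detH0.
pose PQ : {poly rat} := map_poly intr P.
have PQu0 n : shift_act PQ (intr \o u) n = 0 by rewrite shift_act_map Pu0.
have PQ_mon : PQ \is monic by rewrite monic_map.
have sPQ : size PQ = r.+1 by rewrite size_map_inj_poly //; exact: intr_inj.
have [n] : exists n, shift_act (rVpoly w) (intr \o u) n != 0.
  apply: (lower_degree_act_neq0 P_irr PQu0).
  - by apply: contraNneq w0 => Dw0; rewrite -[w]rVpolyK Dw0 linear0.
  - by rewrite -/PQ sPQ ltnS; exact: size_poly.
  - by exists m; rewrite intr_eq0.
apply/negP; rewrite negbK; apply/eqP; move: n.
apply: (shift_act_init0 PQ_mon) => [n|n].
  by rewrite -shift_actM mulrC shift_actM shift_act_eq0.
by rewrite sPQ /= => lt_nr; rewrite -(act_row _ w (Ordinal lt_nr)) wH0 mxE.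
Qed.

(** * The modulus on the complex numbers *)

Section Modulus.
Variable R : realType.
Implicit Types (v w : R[i]) (t : R) (n : nat).

Lemma cmodE w : cmod w = ComplexField.Normc.normc w.
Proof. by []. Qed.

Lemma cmodM v w : cmod (v * w) = cmod v * cmod w.
Proof. exact: ComplexField.Normc.normcM. Qed.

Lemma cmodD v w : cmod (v + w) <= cmod v + cmod w.
Proof. exact: le_normcD. Qed.

Lemma cmod_ge0 w : 0 <= cmod w.
Proof. by case: w => x y; exact: sqrtr_ge0. Qed.

Lemma normc_cmod w : `|w| = (cmod w)%:C.
Proof. by []. Qed.

Lemma cmod_real t : cmod t%:C = `|t|.
Proof. by rewrite cmodE /= expr0n addr0 sqrtr_sqr. Qed.

Lemma cmodN w : cmod (- w) = cmod w.
Proof. exact: normcN. Qed.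

Lemma cmodX w n : cmod (w ^+ n) = cmod w ^+ n.
Proof.
elim: n => [|n IH]; first by rewrite !expr0 cmod_real normr1.
by rewrite !exprS cmodM IH.
Qed.

Lemma cmod_nat n : cmod (n%:R : R[i]) = n%:R :> R.
Proof.
have -> : n%:R = (n%:R)%:C :> R[i] by rewrite rmorph_nat.
by rewrite cmod_real normr_nat.
Qed.

Lemma cmod_sum_le (w : nat -> R[i]) (m n : nat) :
  cmod (\sum_(m <= i < n) w i) <= \sum_(m <= i < n) cmod (w i).
Proof.
elim/big_ind2 : _ => [|v b v' b' le1 le2|//]; first by rewrite cmod_real normr0.
exact: le_trans (cmodD _ _) (lerD le1 le2).
Qed.

Lemma cmod_le_ReIm w : cmod w <= `|complex.Re w| + `|complex.Im w|.
Proof.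
have cmodi : cmod ('i : R[i]) = 1.
  by rewrite cmodE /= expr0n expr1n add0r sqrtr1.
rewrite {1}[w]complexE; apply: (le_trans (cmodD _ _)).
by rewrite cmodM !cmod_real cmodi mul1r.
Qed.

Lemma Re_le_cmod w : `|complex.Re w| <= cmod w.
Proof.
case: w => a b; rewrite cmodE /= -sqrtr_sqr ler_sqrt ?lerDl ?sqr_ge0 //.
by rewrite addr_ge0 ?sqr_ge0.
Qed.

Lemma Im_le_cmod w : `|complex.Im w| <= cmod w.
Proof.
case: w => a b; rewrite cmodE /= -sqrtr_sqr ler_sqrt ?lerDr ?sqr_ge0 //.
by rewrite addr_ge0 ?sqr_ge0.
Qed.

Lemma ReD v w : complex.Re (v + w) = complex.Re v + complex.Re w.
Proof. by case: v w => [a b] [c d]. Qed.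

Lemma ImD v w : complex.Im (v + w) = complex.Im v + complex.Im w.
Proof. by case: v w => [a b] [c d]. Qed.

Lemma ReM v w : complex.Re (v * w) =
  complex.Re v * complex.Re w - complex.Im v * complex.Im w.
Proof. by case: v w => [a b] [c d]. Qed.

Lemma ImM v w : complex.Im (v * w) =
  complex.Re v * complex.Im w + complex.Im v * complex.Re w.
Proof. by case: v w => [a b] [c d]. Qed.

End Modulus.

(** * Growth of the recurrence sequence *)

Section Growth.
Variable R : realType.

(** With P = Q * (X - alpha), the sequence b = Q(nabla) u satisfies
    b_n = b_0 alpha^n and, u being nondecreasing, |b_n| <= M u_(n + r), where
    r is the size of Q; and b_0 is not 0 since Q has smaller degree than P. *)
Lemma recurrence_lower_bound (u : nat -> int) (P : {poly int}) (alpha : R) :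
  P \is monic -> irreducible_over_rat P -> (forall n, shift_act P u n = 0) ->
  1 <= alpha -> root (map_poly intr P) alpha ->
  (forall n, 0 < u n) -> (forall m n, (m <= n)%N -> u m <= u n) ->
  exists2 c : R, 0 < c & forall n, c * alpha ^+ n <= (u n)%:~R.
Proof.
move=> P_mon P_irr Pu0 alpha_ge1 /factor_theorem[Q PQ] u_gt0 u_mono.
have sP : size (map_poly (intr : int -> R) P) = size P.
  by rewrite size_map_inj_poly //; exact: intr_inj.
have Q0 : Q != 0.
  apply: contraTneq (monic_neq0 P_mon) => Q0.
  by rewrite negbK -size_poly_eq0 -sP PQ Q0 mul0r size_poly0.
have lt_QP : (size Q < size P)%N.
  by rewrite -sP PQ size_Mmonic ?monicXsubC // size_XsubC addn2.
pose v : nat -> R := intr \o u.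
pose b := shift_act Q v.
have b_geo n : b n = b 0%N * alpha ^+ n.
  elim: n => [|n IH]; first by rewrite mulr1.
  apply/eqP; rewrite exprS mulrCA -IH -subr_eq0 -shift_act_XsubC -shift_actM.
  by rewrite mulrC -PQ shift_act_map Pu0.
have b0 : 0 < `|b 0%N|.
  have [|n] := lower_degree_act_neq0_ext P_mon P_irr Pu0 _ Q0 lt_QP.
    by exists 0%N; rewrite gt_eqF.
  by rewrite -/b b_geo normr_gt0; apply: contraNneq => ->; rewrite mul0r.
(* The summand 1 only serves to make M positive at once. *)
pose r := size Q; pose M := 1 + \sum_(i < r) `|Q`_i|.
have M_gt0 : 0 < M by rewrite ltr_wpDr // sumr_ge0.
have v_gt0 n : 0 < v n by rewrite ltr0z.
have v_mono m n : (m <= n)%N -> v m <= v n by move=> mn; rewrite ler_int u_mono.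
have b_le n : `|b n| <= M * v (n + r)%N.
  apply: (le_trans (ler_norm_sum _ _ _)); rewrite mulrDl mul1r mulr_suml.
  apply: ler_wpDl; first exact: ltW.
  apply: ler_sum => i _; rewrite normrM ler_wpM2l //.
  by rewrite gtr0_norm // v_mono // leq_add2l ltnW.
have alpha_gt0 : 0 < alpha by exact: lt_le_trans alpha_ge1.
have ar_gt0 : 0 < alpha ^+ r by exact: exprn_gt0.
(* For n < r the bound through b says nothing; there u_n >= 1 suffices, which is
   why the constant is capped by 1 before the division by alpha ^+ r. *)
pose c := Num.min (`|b 0%N| / M) 1.
exists (c / alpha ^+ r) => [|n].
  by rewrite divr_gt0 // lt_min ltr01 divr_gt0.
rewrite mulrAC ler_pdivrMr //; have [le_rn|lt_nr] := leqP r n.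
  rewrite -(subnK le_rn) exprD mulrA (ler_wpM2r (ltW ar_gt0)) //.
  rewrite -(ler_pM2l M_gt0); apply: le_trans (b_le _).
  rewrite b_geo normrM (gtr0_norm (exprn_gt0 _ alpha_gt0)) mulrA.
  apply: ler_wpM2r; first by rewrite exprn_ge0 // ltW.
  by rewrite [M * c]mulrC -(ler_pdivlMr _ _ M_gt0) /c ge_min lexx.
have v_ge1 : 1 <= v n by rewrite (ler_int _ 1) -gtz0_ge1.
apply: (@le_trans _ _ (1 * alpha ^+ r)).
  have c_ge0 : 0 <= c by rewrite ltW // lt_min ltr01 divr_gt0.
  apply: ler_pM => //; first by rewrite exprn_ge0 // ltW.
    by rewrite ge_min lexx orbT.
  by rewrite ler_weXn2l // ltnW.
exact: ler_wpM2r (ltW ar_gt0) _ _ v_ge1.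
Qed.

(** A factor X - r with |r| < beta does not spoil a bound C beta^n: if D is
    large enough that C + |r| D <= beta D, then D beta^n is a bound for u by
    induction. *)
Lemma first_order_growth (r : R[i]) (beta : R) (u : nat -> R[i]) :
  cmod r < beta ->
  (exists C, forall n, cmod (u n.+1 - r * u n) <= C * beta ^+ n) ->
  exists C, forall n, cmod (u n) <= C * beta ^+ n.
Proof.
move=> r_lt [C Cu]; have d_gt0 : 0 < beta - cmod r by rewrite subr_gt0.
have b_gt0 : 0 < beta by apply: le_lt_trans r_lt; exact: cmod_ge0.
exists (Num.max (cmod (u 0%N)) (C / (beta - cmod r))).
set D := Num.max _ _; elim=> [|n IH]; first by rewrite mulr1 le_max lexx.
rewrite -[u n.+1](subrK (r * u n)); apply: (le_trans (cmodD _ _)).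
apply: (@le_trans _ _ (C * beta ^+ n + cmod r * (D * beta ^+ n))).
  by rewrite lerD // cmodM ler_wpM2l // cmod_ge0.
rewrite exprS (mulrA (cmod r)) -mulrDl (mulrA D); apply: ler_wpM2r.
  by rewrite exprn_ge0 // ltW.
by rewrite -lerBrDr [D * _]mulrC -mulrBl -ler_pdivrMl // mulrC le_max lexx orbT.
Qed.

(** Factors are removed one at a time, so repeated roots need no separate
    treatment. *)
Lemma split_recurrence_growth (rs : seq R[i]) (beta : R) (u : nat -> R[i]) :
  all (fun r => cmod r < beta) rs ->
  (forall n, shift_act (\prod_(r <- rs) ('X - r%:P)) u n = 0) ->
  exists C, forall n, cmod (u n) <= C * beta ^+ n.
Proof.
elim: rs u => [|r rs IH] u /= rs_lt prod_u0.
  exists 0 => n; rewrite mul0r -[u n]mul1r -shift_actC polyC1.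
  by move: (prod_u0 n); rewrite big_nil => ->; rewrite cmod_real normr0.
move/andP: rs_lt => [r_lt rs_lt].
have [|C Cv] := IH (shift_act ('X - r%:P) u) rs_lt.
  by move=> n; rewrite -shift_actM mulrC -(prod_u0 n) big_cons.
apply: (first_order_growth r_lt); exists C => n.
by rewrite -shift_act_XsubC.
Qed.

Lemma recurrence_upper_bound (u : nat -> int) (P : {poly int}) (beta : R) :
  P \is monic -> (forall n, shift_act P u n = 0) ->
  (forall w, complex_root P w -> cmod w < beta) ->
  exists C : R, forall n, `|(u n)%:~R : R| <= C * beta ^+ n.
Proof.
move=> P_mon Pu0 roots_lt; pose PC : {poly R[i]} := map_poly intr P.
have PC_mon : PC \is monic by rewrite monic_map.
have [rs PCrs] := closed_field_poly_normal PC.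
rewrite (monicP PC_mon) scale1r in PCrs.
have [||C Cu] := @split_recurrence_growth rs beta (intr \o u).
- apply/allP => r r_in; apply: roots_lt.
  by rewrite /complex_root -/PC PCrs root_prod_XsubC.
- by move=> n; rewrite -PCrs shift_act_map Pu0.
by exists C => n; rewrite -cmod_real rmorph_int; exact: Cu.
Qed.

Lemma complex_root_real (P : {poly int}) (t : R) :
  complex_root P t%:C = root (map_poly intr P) t :> Prop.
Proof.
rewrite /complex_root -(fmorph_root (real_complex R)) -map_poly_comp.
by congr (is_true (root _ _)); apply: eq_map_poly => k /=; rewrite rmorph_int.
Qed.

(** The two-sided form of a_n = alpha^(n + o(n)), uniform in the offset y.  The
    logarithmic form serves exponents s with real part of either sign at
    once. *)
Lemma log_growth (a : nat -> int) (P : {poly int}) (alpha eps : R) :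
  P \is monic -> annihilates P a -> irreducible_over_rat P ->
  dominant_root P alpha -> (forall n, (0 < n)%N -> 0 < a n) ->
  strictly_increasing a -> 0 < eps ->
  exists C : R, forall n (y : R), 0 <= y -> y < 1 ->
    `|ln ((a n.+1)%:~R + y) - ln alpha *+ n| <= C + eps *+ n.
Proof.
move=> P_mon Pa P_irr [P_alpha alpha_gt1 dom] a_pos a_incr eps_gt0.
pose u : nat -> int := a \o succn.
have Pu0 n : shift_act P u n = 0 by exact: annihilates_shift_act.
have u_gt0 n : 0 < u n by exact: a_pos.
have u_mono m n : (m <= n)%N -> u m <= u n.
  by rewrite leq_eqVlt => /predU1P[->|mn] //; apply/ltW/a_incr.
rewrite complex_root_real in P_alpha.
have [c c_gt0 c_le] :=
  recurrence_lower_bound P_mon P_irr Pu0 (ltW alpha_gt1) P_alpha u_gt0 u_mono.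
have alpha_gt0 : 0 < alpha by apply: lt_trans alpha_gt1.
(* The upper bound is applied with beta chosen so that
   ln beta = ln alpha + eps; the offset y < 1 costs at most a factor 2. *)
pose beta := alpha * expR eps.
have beta_gt : alpha < beta by rewrite ltr_pMr // expR_gt1.
have beta_gt0 : 0 < beta by apply: lt_trans beta_gt.
have [|C C_le] := @recurrence_upper_bound u P beta P_mon Pu0.
  move=> w Pw; have [->|w_ne] := eqVneq w alpha%:C; last first.
    exact: lt_trans (dom _ Pw w_ne) beta_gt.
  by rewrite cmod_real gtr0_norm.
have v_gt0 n : 0 < (u n)%:~R :> R by rewrite ltr0z.
have C_gt0 : 0 < C.
  move: (C_le 0%N); rewrite expr0 mulr1; apply: lt_le_trans.
  by rewrite normr_gt0 gt_eqF.
exists (`|ln c| + `|ln (2 * C)|) => n y y_ge0 y_lt1.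
have t_gt0 : 0 < (a n.+1)%:~R + y by rewrite ltr_wpDr // v_gt0.
have lower : ln c + ln alpha *+ n <= ln ((a n.+1)%:~R + y).
  rewrite -lnXn // -lnM ?posrE ?exprn_gt0 //.
  rewrite ler_ln ?posrE ?mulr_gt0 ?exprn_gt0 //.
  by apply: (le_trans (c_le n)); rewrite lerDl.
have upper : ln ((a n.+1)%:~R + y) <= ln (2 * C) + (ln alpha + eps) *+ n.
  have -> : ln alpha + eps = ln beta by rewrite lnM ?posrE ?expR_gt0 // expRK.
  have C2_gt0 : 0 < 2 * C by rewrite mulr_gt0.
  have bn_gt0 : 0 < beta ^+ n by rewrite exprn_gt0.
  rewrite -lnXn // -lnM // ler_ln ?posrE ?mulr_gt0 //.
  move: (C_le n); rewrite gtr0_norm // => Cn; rewrite -mulrA mulr_natl mulr2n.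
  rewrite lerD //; apply/(le_trans (ltW y_lt1))/(le_trans _ Cn).
  by rewrite (ler_int _ 1) -gtz0_ge1.
rewrite mulrnDl in upper.
have := ler_norm (ln (2 * C)); have := normr_ge0 (ln (2 * C)).
have := ler_norm (- ln c); rewrite normrN; have := normr_ge0 (ln c).
have := mulrn_wge0 n (ltW eps_gt0).
move: (eps *+ n) (ln alpha *+ n) lower upper `|ln c| `|ln (2 * C)|.
move=> e l lo up A B *.
by rewrite ler_norml; apply/andP; split; lra.
Qed.
End Growth.

(** * Complex powers and the binomial series *)

Section Power.
Variable R : realType.
Implicit Types (v w s : R[i]) (t : R).

Lemma cexpD v w : cexp (v + w) = cexp v * cexp w.
Proof.
case: v w => [a b] [c d]; rewrite /cexp /= expRD cosD sinD.
by apply/eqP; rewrite eq_complex /=; apply/andP; split; apply/eqP; ring.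
Qed.

Lemma cexp0 : cexp (0 : R[i]) = 1.
Proof.
rewrite /cexp /= expR0 cos0 sin0.
by apply/eqP; rewrite eq_complex /=; apply/andP; split; apply/eqP; ring.
Qed.

Lemma cmod_cexp w : cmod (cexp w) = expR (complex.Re w).
Proof.
rewrite /cexp cmodM cmod_real gtr0_norm ?expR_gt0 // cmodE /= cos2Dsin2.
by rewrite sqrtr1 mulr1.
Qed.

Lemma cmod_cpow t s : cmod (cpow t s) = expR (complex.Re s * ln t).
Proof. by case: s => a b; rewrite /cpow cmod_cexp /= mulr0 subr0. Qed.

Lemma cpowDr t v w : cpow t (v + w) = cpow t v * cpow t w.
Proof. by rewrite /cpow mulrDl cexpD. Qed.

Lemma cpowr0 t : cpow t (0 : R[i]) = 1.
Proof. by rewrite /cpow mul0r cexp0. Qed.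

Lemma cpowrN t s : cpow t (- s) = (cpow t s)^-1.
Proof.
have sK : cpow t (- s) * cpow t s = 1 by rewrite -cpowDr addNr cpowr0.
have s0 : cpow t s != 0.
  by apply: contra_eq_neq sK => ->; rewrite mulr0 eq_sym oner_eq0.
by apply: (mulIf s0); rewrite sK mulVf.
Qed.

Lemma cpow1r s : cpow 1 s = 1.
Proof. by rewrite /cpow ln1 mulr0 cexp0. Qed.

Lemma cpowMl t1 t2 s : 0 < t1 -> 0 < t2 ->
  cpow (t1 * t2) s = cpow t1 s * cpow t2 s.
Proof. by move=> *; rewrite /cpow lnM ?posrE // rmorphD mulrDr cexpD. Qed.

Lemma cpowr_nat t n : 0 < t -> cpow t n%:R = t%:C ^+ n.
Proof.
move=> t_gt0; have cpow1 : cpow t 1 = t%:C.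
  rewrite /cpow mul1r /cexp /= cos0 sin0 lnK ?posrE //.
  by apply/eqP; rewrite eq_complex /=; apply/andP; split; apply/eqP; ring.
elim: n => [|n IH]; first exact: cpowr0.
by rewrite exprS -natr1 cpowDr IH cpow1 mulrC.
Qed.

(** Derivative of a complex-valued function of a real variable, taken on the
    real and imaginary parts because the mean value theorem applies to
    real-valued functions only. *)
Definition is_cderive (f : R -> R[i]) (y : R) (df : R[i]) : Prop :=
  is_derive y 1 (fun t => complex.Re (f t)) (complex.Re df) /\
  is_derive y 1 (fun t => complex.Im (f t)) (complex.Im df).

Lemma is_cderive_cst (c : R[i]) y : is_cderive (fun=> c) y 0.
Proof. by split; exact: is_derive_cst. Qed.

Lemma is_cderive_real (f : R -> R) (y df : R) :
  is_derive y 1 f df -> is_cderive (fun t => (f t)%:C) y df%:C.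
Proof. by move=> dF; split => //=; exact: is_derive_cst. Qed.

Lemma is_cderiveD f g y df dg : is_cderive f y df -> is_cderive g y dg ->
  is_cderive (fun t => f t + g t) y (df + dg).
Proof.
move=> [fr fi] [gr gi]; split.
  rewrite ReD; have := is_deriveD fr gr; congr is_derive.
  by apply/funext => t; rewrite ReD.
rewrite ImD; have := is_deriveD fi gi; congr is_derive.
by apply/funext => t; rewrite ImD.
Qed.

Lemma is_cderiveM f g y df dg : is_cderive f y df -> is_cderive g y dg ->
  is_cderive (fun t => f t * g t) y (df * g y + f y * dg).
Proof.
move=> [fr fi] [gr gi]; split.
  rewrite (_ : (fun t => _) =
    (fun t => complex.Re (f t)) * (fun t => complex.Re (g t))
    - (fun t => complex.Im (f t)) * (fun t => complex.Im (g t))); last first.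
    by apply/funext => t; rewrite ReM.
  apply: is_derive_eq (is_deriveB (is_deriveM fr gr) (is_deriveM fi gi)) _.
  by rewrite ReD !ReM /GRing.scale /=; ring.
rewrite (_ : (fun t => _) =
  (fun t => complex.Re (f t)) * (fun t => complex.Im (g t))
  + (fun t => complex.Im (f t)) * (fun t => complex.Re (g t))); last first.
  by apply/funext => t; rewrite ImM.
apply: is_derive_eq (is_deriveD (is_deriveM fr gi) (is_deriveM fi gr)) _.
by rewrite ImD !ImM /GRing.scale /=; ring.
Qed.

Lemma is_cderive_cpow s y : -1 < y ->
  is_cderive (fun t => cpow (1 + t) s) y (s * cpow (1 + y) (s - 1)).
Proof.
move=> y_gt; have y1_gt0 : 0 < 1 + y by lra.
have dln : is_derive y 1 (fun t => ln (1 + t)) (1 + y)^-1.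
  have d1 : is_derive y 1 (fun t : R => 1 + t) 1.
    have := is_deriveD (is_derive_cst (1 : R) y (1 : R))
                       (is_derive_id y (1 : R)).
    by rewrite add0r.
  have := is_derive1_comp (is_derive1_ln y1_gt0) d1.
  by rewrite mulr1.
case: s => a b.
have dlin c : is_derive y 1 (fun t => c * ln (1 + t)) (c * (1 + y)^-1).
  exact: is_deriveZ.
have dexp : is_cderive (fun t => (expR (a * ln (1 + t)))%:C) y
    (expR (a * ln (1 + y)) * (a * (1 + y)^-1))%:C.
  exact: is_cderive_real.
have dcis : is_cderive
    (fun t => cos (b * ln (1 + t)) +i* sin (b * ln (1 + t))) y
    (- sin (b * ln (1 + y)) * (b * (1 + y)^-1) +i*
     (cos (b * ln (1 + y)) * (b * (1 + y)^-1))).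
  split.
    exact: (@is_derive1_comp R cos (fun t => b * ln (1 + t)) _ _ _ _ (dlin b)).
  exact: (@is_derive1_comp R sin (fun t => b * ln (1 + t)) _ _ _ _ (dlin b)).
have := is_cderiveM dexp dcis; congr is_cderive.
  by apply/funext => t; rewrite /cpow /cexp /= !mulr0 subr0 add0r.
have -> : cpow (1 + y) (a +i* b - 1) =
    cpow (1 + y) (a +i* b) * ((1 + y)^-1)%:C.
  by rewrite cpowDr cpowrN (cpowr_nat 1) // expr1 fmorphV.
rewrite /cpow /cexp /= !mulr0 subr0 add0r.
by apply/eqP; rewrite eq_complex /=; apply/andP; split; apply/eqP; ring.
Qed.

(** The mean value theorem fails for complex-valued functions; applied to the
    real and imaginary parts separately it gives the inequality up to the
    factor 2. *)
Lemma cderive_mean_value (f : R -> R[i]) (df : R -> R[i]) (b B : R) : 0 <= b ->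
  (forall y, 0 <= y -> y <= b -> is_cderive f y (df y)) ->
  (forall y, 0 <= y -> y <= b -> cmod (df y) <= B) ->
  cmod (f b - f 0) <= 2 * (B * b).
Proof.
move=> b_ge0 fD dfB.
have mv (g dg : R -> R) :
    (forall y, 0 <= y -> y <= b -> is_derive y 1 g (dg y)) ->
    (forall y, 0 <= y -> y <= b -> `|dg y| <= B) -> `|g b - g 0| <= B * b.
  move=> gD dgB; have [||c c_in ->] := @MVT_segment R g dg 0 b b_ge0.
  - by move=> y; rewrite in_itv /= => /andP[y0 yb]; apply: gD; exact: ltW.
  - apply: derivable_within_continuous => y; rewrite in_itv /= => /andP[y0 yb].
    by have [] := gD y y0 yb.
  move: c_in; rewrite in_itv /= => /andP[c0 cb].
  by rewrite subr0 normrM (ger0_norm b_ge0) ler_wpM2r // dgB.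
apply: (le_trans (cmod_le_ReIm _)); rewrite mulr_natl mulr2n !raddfB /=.
apply: lerD.
  apply: (mv (fun t => complex.Re (f t)) (fun t => complex.Re (df t)));
    move=> y y0 yb.
    by have [] := fD y y0 yb.
  exact: le_trans (Re_le_cmod _) (dfB y y0 yb).
apply: (mv (fun t => complex.Im (f t)) (fun t => complex.Im (df t))) => y y0 yb.
  by have [] := fD y y0 yb.
exact: le_trans (Im_le_cmod _) (dfB y y0 yb).
Qed.

Lemma cbinom0 w : cbinom w 0 = 1.
Proof. by rewrite /cbinom big_ord0 divr1. Qed.

Lemma cbinomS w n : n.+1%:R * cbinom w n.+1 = (w - n%:R) * cbinom w n.
Proof.
rewrite /cbinom big_ord_recr /= factS natrM invfM.
have n0 : n.+1%:R != 0 :> R[i] by rewrite pnatr_eq0.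
set p := \prod_(i < n) _; set B := n`!%:R^-1; set d := w - n%:R.
transitivity ((n.+1%:R / n.+1%:R) * (d * (p * B))); last first.
  by rewrite mulfV // mul1r.
move: (n.+1%:R : R[i]) (n.+1%:R^-1 : R[i]) => N N'. ring.
Qed.

Definition binomial_sum s (J : nat) (y : R) : R[i] :=
  \sum_(j < J) cbinom (- s) j * y%:C ^+ j.

(** If binomial_sum were the full series, the product would be constant.  The
    derivative of the J-th partial sum therefore reduces to one boundary term:
    by induction on J, the term added at each step turns the previous boundary
    term into the next one, through
    (J + 1) binom(-s, J + 1) = (- s - J) binom(-s, J). *)
Lemma is_cderive_binomial_sum s J y : -1 < y ->
  is_cderive (fun t => binomial_sum s J t * cpow (1 + t) s) y
    (- (J%:R * cbinom (- s) J * y%:C ^+ J.-1 * cpow (1 + y) (s - 1))).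
Proof.
move=> y_gt; elim: J => [|J IH].
  rewrite !mul0r oppr0; have := is_cderive_cst 0 y; congr is_cderive.
  by apply/funext => t; rewrite /binomial_sum big_ord0 mul0r.
have dX : is_cderive (fun t => t%:C ^+ J) y (J%:R * y%:C ^+ J.-1).
  have dR : is_derive y 1 (fun t : R => t ^+ J) (J%:R * y ^+ J.-1).
    have := is_deriveX J (is_derive_id y (1 : R)).
    by rewrite /GRing.scale /= mulr1 exprfctE.
  have := is_cderive_real dR; rewrite rmorphM rmorphXn rmorph_nat.
  by congr is_cderive; apply/funext => t; rewrite rmorphXn.
have dc := is_cderiveM (is_cderive_cst (cbinom (- s) J) y)
  (is_cderiveM dX (is_cderive_cpow s y_gt)).
have := is_cderiveD IH dc; congr is_cderive.
  by apply/funext => t; rewrite /binomial_sum big_ord_recr /= mulrDl mulrA.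
have cpow1 : cpow (1 + y) s = (1 + y%:C) * cpow (1 + y) (s - 1).
  have -> : 1 + y%:C = (1 + y)%:C by rewrite rmorphD.
  rewrite -[(1 + y)%:C]expr1 -(cpowr_nat 1); last lra.
  by rewrite -cpowDr; congr cpow; rewrite mulr1n [1 + (_ - _)]addrC subrK.
rewrite cpow1 cbinomS /=; case: J {IH dX dc} => [|J] /=.
  by rewrite expr0; ring.
by rewrite exprS; ring.
Qed.

(** The product p(y) (1 + y)^s, with p the partial sum, equals 1 at y = 0, so
    the mean value inequality bounds its distance to 1; the remainder is that
    distance multiplied by |(1 + y)^(-s)|.  The partial sums start at J + 1
    because the empty one does not take the value 1 at 0. *)
Lemma binomial_remainder s x : 0 <= x -> x < 1 ->
  exists C, forall J y, 0 <= y -> y <= x ->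
    cmod (cpow (1 + y) (- s) - binomial_sum s J.+1 y) <=
      C * (J.+1%:R * cmod (cbinom (- s) J.+1) * x ^+ J.+1).
Proof.
move=> x_ge0 x_lt1.
(* A bound for |(1 + y)^w| on [0, 1], for either sign of Re w. *)
pose M w := expR (`|complex.Re w| * ln 2).
have M_bound w (y : R) : 0 <= y -> y <= x -> cmod (cpow (1 + y) w) <= M w.
  move=> y0 yx; rewrite cmod_cpow ler_expR.
  have l_ge0 : 0 <= ln (1 + y) by rewrite ln_ge0 // lerDl.
  apply: (@le_trans _ _ (`|complex.Re w| * ln (1 + y))).
    by rewrite ler_wpM2r // ler_norm.
  by rewrite ler_wpM2l // ler_ln ?posrE; lra.
exists (2 * M (- s) * M (s - 1)) => J y y_ge0 y_lex.
pose b := cbinom (- s) J.+1.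
have y1_gt : -1 < y by lra.
have H0 : binomial_sum s J.+1 0 * cpow (1 + 0) s = 1.
  rewrite addr0 cpow1r mulr1 /binomial_sum big_ord_recl expr0 cbinom0 mulr1.
  by rewrite big1 ?addr0 // => i _; rewrite /= expr0n mulr0.
have mv : cmod (binomial_sum s J.+1 y * cpow (1 + y) s - 1) <=
    2 * (J.+1%:R * cmod b * x ^+ J * M (s - 1) * y).
  rewrite -[X in _ - X]H0.
  apply: (@cderive_mean_value
    (fun t => binomial_sum s J.+1 t * cpow (1 + t) s)
    (fun t => - (J.+1%:R * b * t%:C ^+ J * cpow (1 + t) (s - 1)))) => //.
    by move=> t t0 ty; apply: (is_cderive_binomial_sum s J.+1); lra.
  move=> t t0 ty; have t_lex : t <= x := le_trans ty y_lex.
  rewrite cmodN cmodM (cmodM (_ * b)) (cmodM _ b) cmod_nat cmodX cmod_real.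
  rewrite ger0_norm //.
  apply: ler_pM; rewrite ?mulr_ge0 ?cmod_ge0 ?exprn_ge0 ?M_bound //.
  by rewrite ler_wpM2l ?mulr_ge0 ?cmod_ge0 // lerXn2r.
have -> : cpow (1 + y) (- s) - binomial_sum s J.+1 y =
    - cpow (1 + y) (- s) * (binomial_sum s J.+1 y * cpow (1 + y) s - 1).
  have sK : cpow (1 + y) (- s) * cpow (1 + y) s = 1.
    by rewrite -cpowDr addNr cpowr0.
  rewrite mulrBr mulr1 mulrCA mulNr sK; ring.
rewrite cmodM cmodN.
apply: (@le_trans _ _
  (M (- s) * (2 * (J.+1%:R * cmod b * x ^+ J * M (s - 1) * y)))).
  apply: ler_pM; rewrite ?cmod_ge0 ?M_bound //.
rewrite exprSr -/b.
have -> : M (- s) * (2 * (J.+1%:R * cmod b * x ^+ J * M (s - 1) * y)) =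
  2 * M (- s) * M (s - 1) * (J.+1%:R * cmod b * x ^+ J) * y by ring.
have -> : 2 * M (- s) * M (s - 1) * (J.+1%:R * cmod b * (x ^+ J * x)) =
  2 * M (- s) * M (s - 1) * (J.+1%:R * cmod b * x ^+ J) * x by ring.
by rewrite ler_wpM2l // !mulr_ge0 ?cmod_ge0 ?exprn_ge0 ?expR_ge0.
Qed.
End Power.

(** * Convergence of complex sequences and series *)

Section Convergence.
Variable R : realType.

(** Convergence in the normed complex plane is reduced to that of a real
    sequence, where squeezing is available. *)
Lemma ccvgP (u : nat -> R[i]^o) (l : R[i]^o) :
  u @ \oo --> l <-> (fun n => cmod (l - u n)) @ \oo --> (0 : R).
Proof.
split => [/cvgrPdist_lt ul | ul].
  apply/cvgrPdist_lt => e e_gt0.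
  have /ul : 0 < e%:C by rewrite ltcR.
  apply: filterS => n; rewrite normc_cmod ltcR sub0r normrN.
  by rewrite ger0_norm ?cmod_ge0.
apply/cvgrPdist_lt => -[e e']; rewrite ltcE /= => /andP[/eqP-> e_gt0].
have /cvgrPdist_lt/(_ e e_gt0) := ul.
apply: filterS => n; rewrite sub0r normrN ger0_norm ?cmod_ge0 // => lt_e.
by rewrite normc_cmod complexr0 ltcR.
Qed.

Lemma ccvg_ReIm (u : nat -> R[i]) (l : R[i]) :
  (fun n => complex.Re (u n)) @ \oo --> complex.Re l ->
  (fun n => complex.Im (u n)) @ \oo --> complex.Im l ->
  (u : nat -> R[i]^o) @ \oo --> (l : R[i]^o).
Proof.
move=> ur ui; apply/ccvgP.
have sum0 : (fun n => `|complex.Re (l - u n)| + `|complex.Im (l - u n)|)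
    @ \oo --> (0 : R).
  rewrite -[X in _ --> X]addr0; apply: cvgD; apply/norm_cvg0P.
    rewrite -(subrr (complex.Re l)).
    rewrite (_ : (fun n => _) = (fun n => complex.Re l - complex.Re (u n))).
      exact: cvgB (cvg_cst _) ur.
    by apply/funext => n; rewrite raddfB.
  rewrite -(subrr (complex.Im l)).
  rewrite (_ : (fun n => _) = (fun n => complex.Im l - complex.Im (u n))).
    exact: cvgB (cvg_cst _) ui.
  by apply/funext => n; rewrite raddfB.
apply: squeeze_cvgr (cvg_cst 0) sum0.
by apply: nearW => n; rewrite cmod_ge0 cmod_le_ReIm.
Qed.

Lemma ccvg_cmod_le (u : nat -> R[i]^o) (l : R[i]^o) (B : R) :
  u @ \oo --> l -> (forall n, cmod (u n) <= B) -> cmod l <= B.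
Proof.
move=> /ccvgP ul uB; rewrite leNgt; apply/negP => lt_B.
have /cvgrPdist_lt/(_ (cmod l - B)) := ul; rewrite subr_gt0 => /(_ lt_B).
case=> N _ /(_ N (leqnn N)) /=; rewrite sub0r normrN ger0_norm ?cmod_ge0 //.
have := cmodD (l - u N) (u N); rewrite subrK; have := uB N; lra.
Qed.

Lemma geometric_partial_sum_le (K q : R) N : 0 <= q -> q < 1 -> 0 <= K ->
  \sum_(0 <= n < N) K * q ^+ n <= K / (1 - q).
Proof.
move=> q_ge0 q_lt1 K_ge0.
have -> : \sum_(0 <= n < N) K * q ^+ n = K * (1 - q ^+ N) / (1 - q).
  have := @geometric_seriesE R K q; rewrite lt_eqF // => /(_ isT).
  by move=> /(congr1 (fun f => f N)).
rewrite ler_wpM2r ?invr_ge0 ?subr_ge0 1?[q <= 1]ltW //.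
by rewrite ler_piMr // gerBl exprn_ge0.
Qed.

(** Both the real and the imaginary part converge absolutely. *)
Lemma geometric_majorant_cvg (w : nat -> R[i]) (K q : R) :
  0 <= q -> q < 1 -> (forall n, cmod (w n) <= K * q ^+ n) ->
  cvgn ((fun N => \sum_(0 <= n < N) w n) : nat -> R[i]^o).
Proof.
move=> q_ge0 q_lt1 wK.
have part (f : R[i] -> R) : (forall v, `|f v| <= cmod v) ->
    cvgn (series (fun n => f (w n))).
  move=> f_le; apply: normed_cvg; apply: (@series_le_cvg _ _ (geometric K q)).
  - by move=> n /=.
  - by move=> n /=; apply: le_trans (wK n); exact: cmod_ge0.
  - by move=> n /=; apply: le_trans (wK n).
  - by apply: is_cvg_geometric_series; rewrite ger0_norm.
have cr := part _ (@Re_le_cmod R); have ci := part _ (@Im_le_cmod R).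
apply/cvg_ex; exists (limn (series (fun n => complex.Re (w n))) +i*
  limn (series (fun n => complex.Im (w n)))).
apply: ccvg_ReIm => /=.
  rewrite (_ : (fun n => _) = series (fun n => complex.Re (w n))) //.
  apply/funext => N; rewrite /series /=.
  by elim/big_rec2: _ => // n a b _ <-; rewrite ReD.
rewrite (_ : (fun n => _) = series (fun n => complex.Im (w n))) //.
apply/funext => N; rewrite /series /=.
by elim/big_rec2: _ => // n a b _ <-; rewrite ImD.
Qed.

Lemma cvg_linear_comb (K : numFieldType) (c d : nat -> K)
    (u : nat -> nat -> K^o) (l : nat -> K^o) (J : nat) : (forall j, u j @ \oo --> l j) ->
  (fun N => \sum_(0 <= j < J) c j * u j N * d j : K^o) @ \oo -->
    (\sum_(0 <= j < J) c j * l j * d j : K^o).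
Proof.
move=> ul; elim: J => [|J IH].
  rewrite [X in _ --> X]big_geq //.
  under eq_fun do rewrite big_geq //.
  exact: cvg_cst.
have -> : (\sum_(0 <= j < J.+1) c j * l j * d j : K^o) =
    \sum_(0 <= j < J) c j * l j * d j + c J * l J * d J.
  by rewrite big_nat_recr.
under eq_fun => N do rewrite big_nat_recr //=.
apply: (@cvgD _ K^o) IH _.
by apply: cvgMr_tmp; apply: cvgMl_tmp; exact: ul.
Qed.

Lemma ratio_cvg0 (u : nat -> R) (rho : R) : (forall n, 0 <= u n) ->
  0 <= rho -> rho < 1 -> (\forall n \near \oo, u n.+1 <= rho * u n) ->
  u @ \oo --> (0 : R).
Proof.
move=> u_ge0 rho_ge0 rho_lt1 [N _ u_le]; rewrite -(cvg_shiftn N).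
have geo : geometric (u N) rho @ \oo --> (0 : R).
  by apply: cvg_geometric; rewrite ger0_norm.
apply: squeeze_cvgr (cvg_cst 0) geo; apply: nearW => n /=; rewrite u_ge0 /=.
elim: n => [|n IH]; first by rewrite mulr1.
rewrite exprS mulrCA addSn; apply: le_trans (ler_wpM2l rho_ge0 IH).
by apply: u_le => /=; exact: leq_addl.
Qed.

(** The ratio of consecutive terms is |s + J + 1| x / (J + 1), which tends to
    x < 1 and so is eventually at most (1 + x) / 2. *)
Lemma binomial_error_cvg0 (s : R[i]) (x : R) : 0 <= x -> x < 1 ->
  (fun J => J.+1%:R * cmod (cbinom (- s) J.+1) * x ^+ J.+1) @ \oo --> (0 : R).
Proof.
move=> x_ge0 x_lt1; apply: (@ratio_cvg0 _ ((1 + x) / 2)); [|lra|lra|].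
  by move=> J; rewrite !mulr_ge0 ?cmod_ge0 ?exprn_ge0.
pose N := Num.truncn (2 * (cmod s * x) / (1 - x)).
have x1 : 0 < 1 - x by lra.
near=> J.
have J_ge : cmod s * x <= (1 - x) / 2 * J.+1%:R.
  have : 2 * (cmod s * x) / (1 - x) <= J.+1%:R.
    near: J; exists N => // J /= NJ.
    apply: ltW; apply: lt_le_trans (truncnS_gt _) _.
    by rewrite ler_nat ltnS.
  by rewrite ler_pdivrMr //; lra.
set b := cbinom (- s) J.+1.
have -> : J.+2%:R * cmod (cbinom (- s) J.+2) = cmod (s + J.+1%:R) * cmod b.
  by rewrite -(cmod_nat R J.+2) -cmodM cbinomS cmodM -opprD cmodN.
rewrite [x ^+ J.+2]exprS.
have -> : (1 + x) / 2 * (J.+1%:R * cmod b * x ^+ J.+1) =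
  ((1 + x) / 2 * J.+1%:R) * (cmod b * x ^+ J.+1) by ring.
have -> : cmod (s + J.+1%:R) * cmod b * (x * x ^+ J.+1) =
  (cmod (s + J.+1%:R) * x) * (cmod b * x ^+ J.+1) by ring.
apply: ler_wpM2r; first by rewrite mulr_ge0 ?cmod_ge0 ?exprn_ge0.
apply: (@le_trans _ _ ((cmod s + J.+1%:R) * x)).
  by rewrite ler_wpM2r //; have := cmodD s J.+1%:R; rewrite cmod_nat.
by rewrite mulrDl; lra.
Unshelve. all: by end_near.
Qed.

End Convergence.

(** * The Dirichlet series and its expansion *)

Section Dirichlet.
Variables (R : realType) (a : nat -> int).
Implicit Types (z s : R[i]) (x y : R).

(** The term of phi_partial of index n + 1, so that sums start at 0. *)
Definition dterm z s y (n : nat) : R[i] :=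
  z ^+ n.+1 / cpow ((a n.+1)%:~R + y) s.

Lemma phi_partialE z s y N :
  phi_partial a z s y N = \sum_(0 <= n < N) dterm z s y n.
Proof. by rewrite /phi_partial big_add1. Qed.

(** The modulus of the term is exp ((n + 1) ln |z| - Re s * ln (a_(n+1) + y)),
    whose exponent is, by [log_growth], at most a constant plus n times
    ln |z| - Re s * ln alpha + |Re s| eps.  The hypothesis on s makes this
    negative once eps is small. *)
Lemma dterm_majorant (P : {poly int}) (alpha : R) z s :
  P \is monic -> annihilates P a -> irreducible_over_rat P ->
  dominant_root P alpha -> (forall n, (0 < n)%N -> 0 < a n) ->
  strictly_increasing a -> z != 0 -> ln (cmod z) / ln alpha < complex.Re s ->
  exists K q : R, [/\ 0 <= K, 0 <= q, q < 1 &
    forall n y, 0 <= y -> y < 1 -> cmod (dterm z s y n) <= K * q ^+ n].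
Proof.
move=> P_mon Pa P_irr dom a_pos a_incr z0 s_gt.
have [_ alpha_gt1 _] := dom; have L_gt0 := ln_gt0 alpha_gt1.
set m := ln (cmod z) in s_gt; set L := ln alpha in s_gt L_gt0.
set sg := complex.Re s in s_gt *.
have cz_gt0 : 0 < cmod z.
  rewrite lt_neqAle cmod_ge0 andbT eq_sym.
  by apply: contra_neq z0 => /ComplexField.Normc.eq0_normc.
have gap : m < sg * L by rewrite -ltr_pdivrMr.
have sg1 : 0 < `|sg| + 1 by rewrite ltr_wpDl.
pose eps := (sg * L - m) / (2 * (`|sg| + 1)).
have eps_gt0 : 0 < eps by rewrite divr_gt0 ?mulr_gt0 // subr_gt0.
have [C logC] := log_growth P_mon Pa P_irr dom a_pos a_incr eps_gt0.
exists (expR (m + `|sg| * C)), (expR (m - sg * L + `|sg| * eps)).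
split; rewrite ?expR_ge0 //.
  have : eps * (2 * (`|sg| + 1)) = sg * L - m.
    by rewrite /eps mulfVK // gt_eqF ?mulr_gt0.
  by move=> epsE; rewrite -expR0 ltr_expR; lra.
move=> n y y_ge0 y_lt1; rewrite /dterm -cpowrN cmodM cmod_cpow.
have -> : cmod (z ^+ n.+1) = expR (m *+ n.+1).
  by rewrite cmodX -mulr_natl expRM_natl lnK ?posrE.
rewrite -expRM_natl -!expRD ler_expR.
have := logC n y y_ge0 y_lt1; set l := ln _ => lC.
have sl : `|sg * (l - L *+ n)| <= `|sg| * (C + eps *+ n).
  by rewrite normrM ler_wpM2l.
have := ler_norm (- (sg * (l - L *+ n))); rewrite normrN => nl.
have regroup (m' A C' g e k : R) :
    m' + A * C' + k * (m' - g + A * e) =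
    m' + k * m' + (A * (C' + k * e) - k * g).
  by ring.
rewrite regroup !mulr_natl -mulrS -mulrnAr.
rewrite lerD2l raddfN /= -/sg; apply: le_trans (lerB (le_trans nl sl) (lexx _)).
by rewrite mulrBr opprB mulNr addrAC subrr add0r.
Qed.

Lemma dterm_shift z s j n : 0 < a n.+1 ->
  dterm z (s + j%:R) 0 n = dterm z s 0 n * ((a n.+1)%:~R^-1)%:C ^+ j.
Proof.
move=> an_gt0; rewrite /dterm addr0 cpowDr invfM mulrA.
by rewrite (cpowr_nat j) ?ltr0z // fmorphV exprVn.
Qed.

(** As a_(n+1) >= 1, the majorant of the terms for s serves for every s + j. *)
Lemma cmod_dterm_shift z s j n : 0 < a n.+1 ->
  cmod (dterm z (s + j%:R) 0 n) <= cmod (dterm z s 0 n).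
Proof.
move=> an_gt0; have t_gt0 : 0 < (a n.+1)%:~R :> R by rewrite ltr0z.
have t_ge1 : 1 <= (a n.+1)%:~R :> R by rewrite (ler_int _ 1) -gtz0_ge1.
have ti_ge0 : 0 <= (a n.+1)%:~R^-1 :> R by rewrite invr_ge0 ltW.
have ti_le1 : (a n.+1)%:~R^-1 <= 1 :> R by rewrite invf_le1.
rewrite dterm_shift // cmodM ler_piMr ?cmod_ge0 // cmodX cmod_real.
by rewrite ger0_norm ?exprn_ge0 // exprn_ile1.
Qed.

Lemma dterm_binomial z s x J n : 0 < a n.+1 -> 0 <= x ->
  dterm z s x n -
    \sum_(0 <= j < J) cbinom (- s) j * dterm z (s + j%:R) 0 n * x%:C ^+ j =
  dterm z s 0 n * (cpow (1 + x / (a n.+1)%:~R) (- s) -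
                   binomial_sum s J (x / (a n.+1)%:~R)).
Proof.
move=> an_gt0 x_ge0; rewrite mulrBr; congr (_ - _).
  rewrite /dterm -!cpowrN addr0; set t := (a n.+1)%:~R.
  have t_gt0 : 0 < t by rewrite ltr0z.
  have -> : t + x = t * (1 + x / t).
    by rewrite mulrDr mulr1 mulrCA mulfV ?mulr1 ?gt_eqF.
  by rewrite cpowMl ?mulrA // ltr_wpDr ?divr_ge0 // ltW.
rewrite big_mkord mulr_sumr; apply: eq_bigr => j _.
by rewrite dterm_shift // rmorphM exprMn; ring.
Qed.

(** For fixed J both sides are limits over N of finite sums, so their difference
    is the limit of the sums of the right-hand side of [dterm_binomial], each at
    most (K q^n) times a bound on the binomial remainder independent of n. *)
Lemma phi_expansion z s x (K q : R) :
  (forall n, (0 < n)%N -> 0 < a n) ->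
  0 <= x -> x < 1 -> 0 <= K -> 0 <= q -> q < 1 ->
  (forall n y, 0 <= y -> y < 1 -> cmod (dterm z s y n) <= K * q ^+ n) ->
  [/\ cvgn (phi_partial a z s x),
      forall j : nat, cvgn (phi_partial a z (s + j%:R) 0) &
      (fun J : nat => \sum_(0 <= j < J)
         cbinom (- s) j * phi a z (s + j%:R) 0 * x%:C ^+ j : R[i]^o) @ \oo
        --> phi a z s x].
Proof.
move=> a_pos x_ge0 x_lt1 K_ge0 q_ge0 q_lt1 majK.
have partE y t : phi_partial a z t y =
    (fun N => \sum_(0 <= n < N) dterm z t y n).
  by apply/funext => N; exact: phi_partialE.
have cvx : cvgn (phi_partial a z s x).
  rewrite partE; apply: (geometric_majorant_cvg q_ge0 q_lt1) => n.
  exact: majK.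
have cv0 j : cvgn (phi_partial a z (s + j%:R) 0).
  rewrite partE; apply: (geometric_majorant_cvg q_ge0 q_lt1) => n.
  exact: le_trans (cmod_dterm_shift _ _ _ (a_pos n.+1 isT)) (majK n 0 _ _).
split=> //; apply/ccvgP.
have [C remC] := binomial_remainder s x_ge0 x_lt1.
pose err J := J.+1%:R * cmod (cbinom (- s) J.+1) * x ^+ J.+1.
pose S J : R[i]^o :=
  \sum_(0 <= j < J) cbinom (- s) j * phi a z (s + j%:R) 0 * x%:C ^+ j.
have S_le J : cmod (phi a z s x - S J.+1) <= K / (1 - q) * (C * err J).
  pose Spart J N : R[i]^o := \sum_(0 <= j < J)
    cbinom (- s) j * phi_partial a z (s + j%:R) 0 N * x%:C ^+ j.
  have SpartP j : Spart j @ \oo --> S j by exact: cvg_linear_comb.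
  have dist : (fun N => phi_partial a z s x N - Spart J.+1 N) @ \oo -->
      (phi a z s x - S J.+1 : R[i]^o).
    exact: (@cvgB _ R[i]^o) cvx (SpartP J.+1).
  apply: (ccvg_cmod_le dist) => N.
  have -> : phi_partial a z s x N - Spart J.+1 N = \sum_(0 <= n < N)
      dterm z s 0 n * (cpow (1 + x / (a n.+1)%:~R) (- s) -
                       binomial_sum s J.+1 (x / (a n.+1)%:~R)).
    rewrite phi_partialE /Spart.
    under [X in _ - X]eq_bigr do rewrite phi_partialE mulr_sumr mulr_suml.
    rewrite exchange_big /= -sumrB; apply: eq_bigr => n _.
    by rewrite -dterm_binomial ?a_pos.
  apply: (le_trans (cmod_sum_le _ _ _)).
  have err_ge0 : 0 <= C * err J.
    by apply: le_trans (remC J 0 (lexx 0) x_ge0); exact: cmod_ge0.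
  apply: (@le_trans _ _ (\sum_(0 <= n < N) K * q ^+ n * (C * err J))).
    apply: ler_sum => n _; rewrite cmodM.
    apply: ler_pM; rewrite ?cmod_ge0 ?majK //.
    have t_ge1 : 1 <= (a n.+1)%:~R :> R.
      by rewrite (ler_int _ 1) -gtz0_ge1 a_pos.
    have t_gt0 : 0 < (a n.+1)%:~R :> R by rewrite ltr0z a_pos.
    apply: remC; first by rewrite divr_ge0 // ltW.
    by rewrite ler_pdivrMr // ler_peMr.
  by rewrite -mulr_suml ler_wpM2r // geometric_partial_sum_le.
(* [S_le] speaks of nonempty partial sums only. *)
rewrite -cvg_shiftS.
have err0 : (fun J => K / (1 - q) * (C * err J)) @ \oo --> (0 : R).
  rewrite -(mulr0 (K / (1 - q))); apply: cvgMl_tmp.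
  by rewrite -(mulr0 C); apply: cvgMl_tmp; exact: binomial_error_cvg0.
apply: squeeze_cvgr (cvg_cst 0) err0.
by apply: nearW => J; rewrite cmod_ge0 S_le.
Qed.

End Dirichlet.

Theorem theorem3p3 (R : realType) (a : nat -> int) (P : {poly int})
    (alpha1 : R)
    (a_linrec : linear_recurrence a)
    (a_minpoly : minimal_polynomial a P)
    (P_irr : irreducible_over_rat P)
    (alpha1_dom : dominant_root P alpha1)
    (a_pos : forall n, (0 < n)%N -> 0 < a n)
    (a_incr : strictly_increasing a)
    (z : R[i]) (z_neq0 : z != 0)
    (x : R) (x_ge0 : 0 <= x) (x_lt1 : x < 1)
    (s : R[i]) (s_gt : ln (cmod z) / ln alpha1 < complex.Re s) :
  [/\ cvgn (phi_partial a z s x),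
      forall j : nat, cvgn (phi_partial a z (s + j%:R) 0) &
      (fun J : nat => \sum_(0 <= j < J)
         cbinom (- s) j * phi a z (s + j%:R) 0 * x%:C ^+ j : R[i]^o) @ \oo
        --> phi a z s x].
Proof.
have [P_mon Pa _] := a_minpoly.
have [K [q [K_ge0 q_ge0 q_lt1 majK]]] :=
  dterm_majorant P_mon Pa P_irr alpha1_dom a_pos a_incr z_neq0 s_gt.
exact: (phi_expansion a_pos x_ge0 x_lt1 K_ge0 q_ge0 q_lt1 majK).
Qed.
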